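(* Let $(\mathcal{X},d)$ be a complete separable metric space and $P_1,\dots,P_{J+1}$ Borel probability measures on $\mathcal{X}$ with $\mathbb{E}_{P_j}[d(Y,y_0)]<\infty$ for some $y_0\in\mathcal{X}$ and all $j$. Assume $\{P_2,\dots,P_{J+1}\}$ are affinely independent ($\sum_{j=2}^{J+1}\alpha_jP_j=0$ and $\sum_j\alpha_j=0$ imply all $\alpha_j=0$) and let $\eta>0$. For each $N$ and each $j\in\{1,\dots,J+1\}$ let $Y_j^{(1)},\dots,Y_j^{(N)}$ be i.i.d. draws from $P_j$ and $\hat P_{j,N}=\frac1N\sum_{k=1}^N\delta_{Y_j^{(k)}}$. Let $$\hat\lambda_N\in\arg\min_{\lambda\in\Delta^{J-1}}\Big[W_1\Big(\sum_{j=2}^{J+1}\lambda_j\hat P_{j,N},\hat P_{1,N}\Big)+\eta\sum_{j=2}^{J+1}\lambda_j\log\lambda_j\Big]$$ and let $\lambda^*$ be the unique minimizer over $\Delta^{J-1}$ of $Q_\eta(\lambda)=W_1(\sum_{j=2}^{J+1}\lambda_jP_j,P_1)+\eta\sum_{j=2}^{J+1}\lambda_j\log\lambda_j$. Then $\hat\lambda_N\to\lambda^*$ in probability as $N\to\infty$.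
   Context: $\Delta^{J-1}=\{\lambda\in\mathbb{R}^J:\lambda_j\ge0,\sum_{j=2}^{J+1}\lambda_j=1\}$ with coordinates indexed by $j=2,\dots,J+1$; $0\log0=0$. $W_1$ is the Wasserstein-1 distance; $\delta_y$ is the Dirac mass at $y$. *)

(* Defs.v *)
From HB Require Import structures.
From mathcomp Require Import all_boot all_order all_algebra.
From mathcomp Require Import all_classical all_reals all_analysis.
Set Implicit Arguments. Unset Strict Implicit. Unset Printing Implicit Defensive.
Import Order.TTheory GRing.Theory Num.Theory.
Import numFieldNormedType.Exports.
Local Open Scope classical_set_scope.
Local Open Scope ring_scope.

Section Defs.
Context {R : realType}.

Definition is_metric {X : Type} (dist : X -> X -> R) :=
  [/\ forall x y, dist x y = 0 <-> x = y,
      forall x y, dist x y = dist y x &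
      forall x y z, dist x z <= dist x y + dist y z].

Definition metric_open {X : Type} (dist : X -> X -> R) : set (set X) :=
  [set U | forall x, U x -> exists2 e : R, 0 < e & [set y | dist x y < e] `<=` U].

Definition metric_cauchy {X : Type} (dist : X -> X -> R) (u : nat -> X) :=
  forall e : R, 0 < e -> exists N, forall m n, (N <= m)%N -> (N <= n)%N -> dist (u m) (u n) < e.

Definition metric_complete {X : Type} (dist : X -> X -> R) :=
  forall u : nat -> X, metric_cauchy dist u ->
    exists l, forall e : R, 0 < e -> exists N, forall n, (N <= n)%N -> dist (u n) l < e.

(* separable: has a countable dense subset (a dense sequence, X being nonempty) *)
Definition metric_separable {X : Type} (dist : X -> X -> R) :=
  (X -> False) \/ exists s : nat -> X,
    forall x (e : R), 0 < e -> exists n, dist x (s n) < e.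

Context {dX : measure_display} {X : measurableType dX}.

Definition coupling (mu nu : set X -> \bar R) (pi : probability (X * X)%type R) :=
  forall A : set X, measurable A -> pi (A `*` setT) = mu A /\ pi (setT `*` A) = nu A.

Definition W1 (dist : X -> X -> R) (mu nu : set X -> \bar R) : \bar R :=
  ereal_inf [set (\int[pi]_z (dist z.1 z.2)%:E)%E
            | pi in [set pi : probability (X * X)%type R | coupling mu nu pi]].

Definition mixture (J : nat) (lam : 'I_J -> R) (mus : 'I_J -> set X -> \bar R) :
  set X -> \bar R := fun A => (\sum_(i < J) (lam i)%:E * mus i A)%E.

Definition empirical {T : Type} (N : nat) (Z : nat -> T -> X) (w : T) :
  set X -> \bar R := fun A => ((N%:R)^-1%:E * \sum_(k < N) (\d_(Z k w) : set X -> \bar R) A)%E.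

Definition simplex (J : nat) : set ('I_J -> R) :=
  [set lam | (forall i, 0 <= lam i) /\ \sum_(i < J) lam i = 1].

Definition xlogx (x : R) : R := if x == 0 then 0 else x * ln x.

Definition objective (dist : X -> X -> R) (eta : R) (J : nat)
    (mus : 'I_J -> set X -> \bar R) (mu1 : set X -> \bar R) (lam : 'I_J -> R) : \bar R :=
  (W1 dist (mixture lam mus) mu1 + (eta * \sum_(i < J) xlogx (lam i))%:E)%E.

Definition is_argmin (J : nat) (Q : ('I_J -> R) -> \bar R) (lam : 'I_J -> R) :=
  @simplex J lam /\ forall l, @simplex J l -> (Q lam <= Q l)%E.

Context {dO : measure_display} {Omega : measurableType dO}.

Definition mutually_independent (Pr : probability Omega R) (Z : nat -> Omega -> X) :=
  forall (s : seq nat) (A : nat -> set X), uniq s -> (forall k, measurable (A k)) ->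
    Pr (\bigcap_(k in [set k | k \in s]) (Z k @^-1` A k)) =
    (\prod_(k <- s) Pr (Z k @^-1` A k))%E.

Definition iid_with_law (Pr : probability Omega R) (Z : nat -> Omega -> X)
    (P : probability X R) :=
  [/\ forall k, measurable_fun setT (Z k),
      forall k A, measurable A -> Pr (Z k @^-1` A) = P A &
      mutually_independent Pr Z].

(* convergence in (outer) probability of a sequence of possibly non-measurable
   maps to a constant, with l1 distance on R^J *)
Definition cvg_in_outer_prob (Pr : probability Omega R) (J : nat)
    (Z : nat -> Omega -> 'I_J -> R) (c : 'I_J -> R) :=
  forall eps delta : R, 0 < eps -> 0 < delta ->
    exists N0, forall N, (N0 <= N)%N ->
      exists2 B : set Omega, measurable B /\
        [set w | eps < \sum_(i < J) `|Z N w i - c i|] `<=` B & (Pr B < delta%:E)%E.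

End Defs.

(* Main.v *)
Require Import Defs.
From HB Require Import structures.
From mathcomp Require Import all_boot all_order all_algebra.
From mathcomp Require Import all_classical all_reals all_analysis.
From mathcomp Require Import measurable_realfun ring lra.
Set Implicit Arguments. Unset Strict Implicit. Unset Printing Implicit Defensive.
Import Order.TTheory GRing.Theory Num.Theory.
Import numFieldNormedType.Exports.
Local Open Scope classical_set_scope.
Local Open Scope ring_scope.

(** Cut X into finitely many measurable cells with centres p such that x is on
    average close to the centre of its cell, under each P_j. The W_1 cost of a
    coupling is then, up to these quantization errors, a function of the masses
    it gives to products of cells. A matrix of masses can be moved to nearby
    marginals at a cost controlled by the change of the cell probabilities, and
    every matrix with the right marginals is realized by a coupling (a mixture
    of products of conditional laws). Hence W_1 is stable under changing both
    measures, without gluing couplings. For empirical measures the quantization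
    error is controlled by Markov's inequality and the cell frequencies by
    Chebyshev's, so with high probability the empirical objective is uniformly
    close to Q_eta on the simplex. Since W_1 is convex along mixtures and the
    entropy is strongly midpoint convex, a near minimizer of Q_eta is
    quantitatively close to lambda^*. *)

(** * Couplings with prescribed cell masses *)

Section Mixtures.
Context {R : realType} {d : measure_display} {T : measurableType d}.
Implicit Types mu : probability T R.

(** Serves couplings, mixtures over the simplex and empirical measures alike: each is a finite
    convex combination of probabilities, and integrals against it are linear in the weights. *)
Lemma finite_mixture_exists (I : finType) (lam : I -> R)
    (mus : I -> probability T R) :
  (forall i, 0 <= lam i) -> \sum_i lam i = 1 ->
  exists q : probability T R,
    (forall A, q A = \sum_i (lam i)%:E * mus i A)%E /\
    (forall f : T -> \bar R, measurable_fun setT f -> (forall x, 0 <= f x)%E ->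
      \int[q]_x f x = \sum_i (lam i)%:E * \int[mus i]_x f x)%E.
Proof.
move=> lam0 lam1.
(* [msum] sums a sequence indexed by [nat], so [I] is enumerated and indices past [#|I|] get the
   zero measure. *)
pose m k : {measure set T -> \bar R} :=
  if insub k is Some j then
    mscale (NngNum (lam0 (enum_val (j : 'I_#|I|)))) (mus (enum_val j))
  else mzero.
have sumE (F : I -> \bar R) : (\sum_i F i = \sum_(j < #|I|) F (enum_val j))%E.
  by rewrite -(big_enum_val F).
have mE A : msum m #|I| A = (\sum_i (lam i)%:E * mus i A)%E.
  rewrite sumE /msum; apply: eq_bigr => j _.
  by rewrite /m valK.
have mT : msum m #|I| setT = 1%E.
  rewrite mE -lam1 -sumEFin; apply: eq_bigr => i _.
  by rewrite probability_setT mule1.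
pose q : probability T R :=
  HB.pack (msum m #|I|) (Measure_isProbability.Build _ _ _ (msum m #|I|) mT).
exists q; split => [A|f mf f0]; first exact: mE.
rewrite /q/= ge0_integral_measure_sum// sumE.
apply: eq_bigr => j _; rewrite /m valK.
by rewrite ge0_integral_mscale.
Qed.

(** The product form avoids a division: if [mu C = 0], [mnormalize] falls back to [mu] and both
    sides vanish. *)
Lemma conditional_probability_exists mu (C : set T) : measurable C ->
  exists q : probability T R, forall A, measurable A ->
    (mu C * q A = mu (A `&` C))%E.
Proof.
move=> mC; exists (mnormalize (mrestr mu mC) mu) => A mA.
have Coo : mu C \is a fin_num by rewrite fin_num_measure.
rewrite /= /mnormalize /= /mrestr setTI.
have [C0|C0] := eqVneq (mu C) 0%E.
  rewrite C0 mul0e; apply/esym/eqP; rewrite eq_le measure_ge0 andbT -C0.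
  by rewrite le_measure ?inE//; exact: measurableI.
have /negPf -> : mu C != +oo%E by apply: contraTneq Coo => ->.
rewrite /= muleCA -[X in (_ * (X * _))%E](fineK Coo) -EFinM divff ?mule1//.
by rewrite fine_eq0.
Qed.

End Mixtures.

Section Cells.
Context {R : realType} {d : measure_display} {X : measurableType d}.
Context {I : finType} (idx : X -> I).
Implicit Types mu nu : probability X R.

Definition cell (a : I) : set X := idx @^-1` [set a].

Hypothesis measurable_cell : forall a, measurable (cell a).

Lemma measure_cells mu (A : set X) : measurable A ->
  mu A = (\sum_a mu (A `&` cell a))%E.
Proof.
move=> mA.
rewrite fsbig_seq ?index_enum_uniq// -measure_fin_bigcup//.
- rewrite -setI_bigcupr (_ : \bigcup_(a in _) _ = setT) ?setIT// -subTset.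
  by move=> x _; exists (idx x) => //=; rewrite mem_index_enum.
- by move=> a b _ _ [x [[_ /= <-] [_ /= <-]]].
- by move=> a _; exact: measurableI.
Qed.

Lemma sum_cells mu : \sum_a fine (mu (cell a)) = 1.
Proof.
apply: EFin_inj; rewrite -sumEFin -(probability_setT mu) (measure_cells mu)//.
by apply: eq_bigr => a _; rewrite setTI fineK// fin_num_measure.
Qed.

(** The coupling is the mixture, with weights [M a b], of products of [mu] conditioned on cell [a]
    and [nu] conditioned on cell [b]. The row and column sums of [M] turn its marginals into total
    probability formulas. *)
Lemma coupling_with_cell_masses mu nu (M : I -> I -> R) :
  (forall a b, 0 <= M a b) ->
  (forall a, \sum_b M a b = fine (mu (cell a))) ->
  (forall b, \sum_a M a b = fine (nu (cell b))) ->
  exists2 pi : probability (X * X)%type R, coupling mu nu pi &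
    forall a b, pi (cell a `*` cell b) = (M a b)%:E.
Proof.
move=> M0 Mmu Mnu.
have /choice[p pP] := fun a => conditional_probability_exists mu (measurable_cell a).
have /choice[q qP] := fun b => conditional_probability_exists nu (measurable_cell b).
pose lam (c : I * I) := M c.1 c.2.
pose mus (c : I * I) : probability (X * X)%type R := (p c.1 \x q c.2)%E.
have lam1 : \sum_c lam c = 1.
  rewrite -(pair_bigA _ (fun a b => M a b))/= -(sum_cells mu).
  by apply: eq_bigr => a _.
have [pi [piE _]] := @finite_mixture_exists _ _ _ _ lam mus (fun c => M0 c.1 c.2) lam1.
have piX A B : measurable A -> measurable B ->
    pi (A `*` B) = (\sum_a \sum_b (M a b)%:E * (p a A * q b B))%E.
  move=> mA mB.
  rewrite piE (pair_bigA _ (fun a b => (M a b)%:E * (p a A * q b B))%E)/=.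
  by apply: eq_bigr => c _; rewrite /mus product_measure1E.
have sumr a : (\sum_b (M a b)%:E)%E = mu (cell a).
  by rewrite sumEFin Mmu fineK// fin_num_measure.
have sumc b : (\sum_a (M a b)%:E)%E = nu (cell b).
  by rewrite sumEFin Mnu fineK// fin_num_measure.
(* The conditional law on a null cell is a default that may charge other cells, but its weight is at
   most the mass of that null cell, hence zero. *)
have offcell (eta : probability X R) (r : I -> probability X R) a a' (x : R) :
    (forall A, measurable A -> eta (cell a) * r a A = eta (A `&` cell a))%E ->
    a != a' -> 0 <= x <= fine (eta (cell a)) -> (x%:E * r a (cell a') = 0)%E.
  move=> rP aa' /andP[x0 xe]; have := rP _ (measurable_cell a').
  rewrite (_ : _ `&` _ = set0); last first.
    by rewrite -subset0 => z [/= za' za]; move: aa'; rewrite -za -za' eqxx.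
  rewrite measure0 => /eqP; rewrite mule_eq0 => /orP[|]/eqP e0.
    have -> : x = 0 by apply/eqP; rewrite eq_le x0 andbT (le_trans xe)// e0.
    by rewrite mul0e.
  by rewrite e0 mule0.
exists pi.
- move=> A mA; split.
  + rewrite piX// (measure_cells mu mA); apply: eq_bigr => a _.
    rewrite -pP// -sumr ge0_sume_distrl; last by move=> b _; rewrite lee_fin.
    by apply: eq_bigr => b _; rewrite probability_setT mule1.
  + rewrite piX// exchange_big (measure_cells nu mA); apply: eq_bigr => b _.
    rewrite -qP// -sumc ge0_sume_distrl; last by move=> a _; rewrite lee_fin.
    by apply: eq_bigr => a _; rewrite probability_setT mul1e.
- move=> a b; rewrite piX//.
  have Mrow a' b' : M a' b' <= fine (mu (cell a')).
    by rewrite -Mmu (bigD1 b')//= lerDl sumr_ge0.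
  have Mcol a' b' : M a' b' <= fine (nu (cell b')).
    by rewrite -Mnu (bigD1 a')//= lerDl sumr_ge0.
  rewrite (bigD1 a)//= (bigD1 b)//= [X in (_ + X + _)%E]big1 ?adde0; last first.
    move=> b' b'b; rewrite muleCA (offcell nu q)// ?mule0//.
      exact: qP.
    by rewrite M0 Mcol.
  rewrite [X in (_ + X)%E]big1 ?adde0; last first.
    move=> a' a'a; rewrite big1// => b' _; rewrite muleA (offcell mu p)// ?mul0e//.
      exact: pP.
    by rewrite M0 Mrow.
  have [z|z] := eqVneq (M a b) 0; first by rewrite z mul0e.
  (* A positive weight forces its cell to have positive mass, and the conditional law then lives on
     that cell. *)
  have self (eta : probability X R) (r : probability X R) c : 0 < fine (eta (cell c)) ->
    (forall A, measurable A -> eta (cell c) * r A = eta (A `&` cell c))%E ->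
    r (cell c) = 1%E.
    move=> e0 /(_ _ (measurable_cell c)); rewrite setIid.
    rewrite -(@fineK _ (eta (cell c))) ?fin_num_measure//.
    rewrite -(@fineK _ (r (cell c))) ?fin_num_measure// -EFinM => -[] h.
    by congr EFin; apply: (mulfI (lt0r_neq0 e0)); rewrite h mulr1.
  have Mp : 0 < M a b by rewrite lt_def z M0.
  rewrite (self mu _ _ (lt_le_trans Mp (Mrow a b)) (pP a)).
  by rewrite (self nu _ _ (lt_le_trans Mp (Mcol a b)) (qP b)) !mule1.
Qed.

End Cells.

(** * Moving a transport matrix to nearby marginals *)

Section TransportMatrices.
Context {R : realType} {I : finType}.
Implicit Types (u v : I -> R) (M D : I -> I -> R).

(** The factor is the minimum of 1 and [y / x], read as 1 if [x = 0]: scaling by it discards only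
    the excess of [x] over [y]. *)
Lemma scaling_factor_exists (x y : R) : 0 <= x -> 0 <= y ->
  exists r, [/\ 0 <= r, r <= 1, x * r <= y & x * (1 - r) <= `|x - y|].
Proof.
move=> x0 y0; have [xy|yx] := leP x y.
  by exists 1; split; rewrite ?mulr1 ?subrr ?mulr0.
have xp : 0 < x by exact: le_lt_trans yx.
exists (y / x); split.
- by rewrite divr_ge0.
- by rewrite ler_pdivrMr// mul1r ltW.
- by rewrite mulrC divfK ?gt_eqF.
- by rewrite mulrBr mulr1 mulrC divfK ?gt_eqF// ler_norm.
Qed.

(* The mass of M that fits under the new marginals stays in place (rows and
   columns are scaled down by rho and sigma); the remaining mass tau is spread
   as a product of the row and column deficits r and t. *)
Lemma transport_matrix_perturbation M D u v u' v' (Dm : R) :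
  (forall a b, 0 <= M a b) ->
  (forall a, \sum_b M a b = u a) -> (forall b, \sum_a M a b = v b) ->
  \sum_a u a = 1 ->
  (forall a, 0 <= u' a) -> (forall b, 0 <= v' b) ->
  \sum_a u' a = 1 -> \sum_b v' b = 1 ->
  (forall a b, 0 <= D a b <= Dm) ->
  exists M' : I -> I -> R,
    [/\ forall a b, 0 <= M' a b,
        forall a, \sum_b M' a b = u' a,
        forall b, \sum_a M' a b = v' b &
        \sum_a \sum_b M' a b * D a b <= \sum_a \sum_b M a b * D a b +
          Dm * (\sum_a `|u a - u' a| + \sum_b `|v b - v' b|)].
Proof.
move=> M0 Mu Mv u1 u'0 v'0 u'1 v'1 Db.
have u0 a : 0 <= u a by rewrite -Mu sumr_ge0.
have v0 b : 0 <= v b by rewrite -Mv sumr_ge0.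
have /choice[rho rhoP] := fun a => scaling_factor_exists (u0 a) (u'0 a).
have /choice[sig sigP] := fun b => scaling_factor_exists (v0 b) (v'0 b).
pose m a b := M a b * (rho a * sig b).
have m0 a b : 0 <= m a b.
  have [? _ _ _] := rhoP a; have [? _ _ _] := sigP b.
  by rewrite !mulr_ge0.
have mM a b : m a b <= M a b.
  have [? ? _ _] := rhoP a; have [? ? _ _] := sigP b.
  by rewrite ler_piMr// mulr_ile1.
pose r a := u' a - \sum_b m a b.
pose t b := v' b - \sum_a m a b.
have r0 a : 0 <= r a.
  have [? ? H _] := rhoP a; rewrite subr_ge0; apply: le_trans H.
  rewrite -Mu mulr_suml; apply: ler_sum => b _.
  have [? ? _ _] := sigP b.
  by rewrite ler_wpM2l// ler_piMr.
have t0 b : 0 <= t b.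
  have [? ? H _] := sigP b; rewrite subr_ge0; apply: le_trans H.
  rewrite -Mv mulr_suml; apply: ler_sum => a _.
  have [? ? _ _] := rhoP a.
  by rewrite ler_wpM2l// ler_piMl.
pose tau := 1 - \sum_a \sum_b m a b.
have rtau : \sum_a r a = tau by rewrite big_split/= u'1 sumrN.
have ttau : \sum_b t b = tau.
  by rewrite big_split/= v'1 sumrN exchange_big.
have tau0 : 0 <= tau by rewrite -rtau sumr_ge0.
(* If [tau = 0] every deficit is zero, so the convention for division by zero keeps the formula of
   the new matrix valid. *)
have divtau (F : I -> R) a : (forall i, 0 <= F i) -> \sum_i F i = tau ->
    F a * (tau / tau) = F a.
  move=> F0 Ft; have [z|nz] := eqVneq tau 0; last by rewrite divff// mulr1.
  move: Ft => /eqP; rewrite z psumr_eq0// => /allP /(_ a).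
  by rewrite mem_index_enum => /(_ isT) /= /eqP ->; rewrite mul0r.
exists (fun a b => m a b + r a * t b / tau); split.
- by move=> a b; rewrite addr_ge0// divr_ge0// mulr_ge0.
- move=> a; rewrite big_split/= -mulr_suml -mulr_sumr ttau -mulrA divtau//.
  by rewrite /r addrC subrK.
- move=> b; rewrite big_split/= -mulr_suml -mulr_suml rtau mulrAC mulrC divtau//.
  by rewrite /t addrC subrK.
have -> : \sum_a \sum_b (m a b + r a * t b / tau) * D a b =
   \sum_a \sum_b m a b * D a b + \sum_a \sum_b r a * t b / tau * D a b.
  rewrite -big_split; apply: eq_bigr => a _; rewrite -big_split.
  by apply: eq_bigr => b _; rewrite mulrDl.
apply: lerD.
  apply: ler_sum => a _; apply: ler_sum => b _.
  by have /andP[? _] := Db a b; rewrite ler_wpM2r.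
apply: (@le_trans _ _ (Dm * tau)).
  rewrite -[leRHS]mulr1; have [z|nz] := eqVneq tau 0.
    rewrite z mulr0 mul0r big1// => a _; rewrite big1// => b _.
    by rewrite invr0 mulr0 mul0r.
  rewrite -[X in _ <= _ * X](divff nz) -[X in _ <= Dm * X * _]rtau -[X in X / _]ttau.
  rewrite mulr_sumr mulr_suml ; apply: ler_sum => a _.
  rewrite mulr_suml mulr_sumr; apply: ler_sum => b _.
  have /andP[D0 D1] := Db a b.
  have -> : Dm * r a * (t b / tau) = r a * t b / tau * Dm by ring.
  by rewrite ler_wpM2l// divr_ge0// mulr_ge0.
(* [I] is inhabited because [u] has total mass 1; this yields [0 <= Dm]. *)
case: (pickP I) => [a0 _|I0]; last first.
  by move: u1; rewrite big_pred0// => /esym/eqP; rewrite oner_eq0.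
have Dm0 : 0 <= Dm by have /andP[D0 D1] := Db a0 a0; exact: le_trans D1.
rewrite ler_wpM2l//.
have -> : tau = \sum_a \sum_b (M a b - m a b).
  rewrite /tau -u1 -sumrB; apply: eq_bigr => a _.
  by rewrite -Mu -sumrB.
(* The mass lost by scaling splits into row and column losses, since [1 - rho a * sig b <= (1 - rho
   a) + (1 - sig b)] for factors in the unit interval. *)
apply: (@le_trans _ _ (\sum_a \sum_b (M a b * (1 - rho a) + M a b * (1 - sig b)))).
  apply: ler_sum => a _; apply: ler_sum => b _.
  rewrite /m -mulrDr -[X in X - _]mulr1 -mulrBr ler_wpM2l//.
  have [? ? _ _] := rhoP a; have [? ? _ _] := sigP b.
  have : 0 <= (1 - rho a) * (1 - sig b) by rewrite mulr_ge0// subr_ge0.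
  by lra.
under eq_bigr do rewrite big_split/=.
rewrite big_split/=; apply: lerD.
  apply: ler_sum => a _; rewrite -mulr_suml Mu.
  by have [] := rhoP a.
rewrite exchange_big/=; apply: ler_sum => b _; rewrite -mulr_suml Mv.
by have [] := sigP b.
Qed.

End TransportMatrices.

(** * Quantization and stability of W1 *)

Section MetricMeasurability.
Context {R : realType} {d : measure_display} {X : measurableType d}.
Variable dist : X -> X -> R.
Hypothesis dist_metric : is_metric dist.

Lemma metric_xx x : dist x x = 0.
Proof. by case: dist_metric => /(_ x x)[_ ->]. Qed.

Lemma metric_sym x y : dist x y = dist y x.
Proof. by case: dist_metric => _ ->. Qed.

Lemma metric_triangle y x z : dist x z <= dist x y + dist y z.
Proof. by case: dist_metric => _ _ ->. Qed.

Lemma metric_ge0 x y : 0 <= dist x y.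
Proof.
have := metric_triangle y x x; rewrite metric_xx (metric_sym y x).
by rewrite -mulr2n pmulrn_lge0.
Qed.

Hypothesis dist_separable : metric_separable dist.
Hypothesis borel : @measurable _ X = <<s metric_open dist >>.

Lemma measurable_fun_ltr_level d' (T : measurableType d') (f : T -> R) :
  (forall r, measurable [set x | f x < r]) -> measurable_fun setT f.
Proof.
move=> mf; apply: (measurability _ (RGenInftyO.measurableE R)).
move=> _ [_ [r ->] <-]; rewrite setTI.
by rewrite (_ : _ @^-1` _ = [set x | f x < r]).
Qed.

Lemma measurable_dist_from x : measurable_fun setT (dist x).
Proof.
apply: measurable_fun_ltr_level => r; rewrite borel.
apply: sub_sigma_algebra => y /= xy.
exists (r - dist x y); first by rewrite subr_gt0.
move=> z /= yz; rewrite (le_lt_trans (metric_triangle y x z))//.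
by rewrite -ltrBrDl.
Qed.

(** By density of [s], [dist z.1 z.2 < r] holds exactly when [dist (s n) z.1 + dist (s n) z.2 < r]
    for some [n]. This countable union brings the level sets back to distances from fixed points. *)
Lemma measurable_dist :
  measurable_fun setT (fun z : X * X => dist z.1 z.2).
Proof.
(* A [measurableType] is pointed, which excludes the empty case of separability. *)
case: dist_separable => [/(_ point)//|[s sd]].
apply: measurable_fun_ltr_level => r.
rewrite (_ : mkset _ =
  \bigcup_n [set z | dist (s n) z.1 + dist (s n) z.2 < r]); last first.
  apply/seteqP; split => [z /= zr|z [n _ /=]]; last first.
    by apply: le_lt_trans; rewrite (metric_sym (s n) z.1) metric_triangle.
  have e0 : 0 < (r - dist z.1 z.2) / 2 by rewrite divr_gt0// subr_gt0.
  have [n zn] := sd z.1 _ e0; exists n => //=.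
  have := metric_triangle z.1 (s n) z.2.
  by rewrite (metric_sym (s n) z.1); lra.
apply: bigcupT_measurable => n.
have mf : measurable_fun setT
    (fun z : X * X => dist (s n) z.1 + dist (s n) z.2).
  by apply: measurable_funD; apply: measurableT_comp => //;
    exact: measurable_dist_from.
have := measurable_fun_ltr mf (measurable_cst r) measurableT.
by move=> /(_ [set true] I); rewrite setTI.
Qed.

Lemma measurable_dist_comp d' (T : measurableType d') (f g : T -> X) :
  measurable_fun setT f -> measurable_fun setT g ->
  measurable_fun setT (fun x => (dist (f x) (g x))%:E).
Proof.
move=> mf mg; apply/measurable_EFinP.
exact: measurableT_comp measurable_dist (measurable_fun_pair mf mg).
Qed.

End MetricMeasurability.

(** * Quantized transport costs and stability of W1 *)

Section Quantization.
Context {R : realType} {d : measure_display} {X : measurableType d}.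
Variable dist : X -> X -> R.
Hypothesis dist_metric : is_metric dist.
Hypothesis dist_separable : metric_separable dist.
Hypothesis borel : @measurable _ X = <<s metric_open dist >>.
Context {I : finType} (idx : X -> I) (p : I -> X).
Hypothesis measurable_cell : forall a, measurable (cell idx a).
Implicit Types mu nu : probability X R.

Definition quantization_error (mu : set X -> \bar R) : \bar R :=
  (\int[mu]_x (dist x (p (idx x)))%:E)%E.

Lemma measurable_quantizer : measurable_fun setT (fun x => p (idx x)).
Proof.
move=> _ A mA; rewrite setTI.
rewrite (_ : _ @^-1` _ = \bigcup_(a in [set a | A (p a)]) cell idx a).
  by apply: fin_bigcup_measurable.
by apply/seteqP; split => [x /= Ax|x [a Aa xa]]; [exists (idx x)|rewrite /= xa].
Qed.

Lemma measurable_quantization_error :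
  measurable_fun setT (fun x => (dist x (p (idx x)))%:E).
Proof.
by apply: measurable_dist_comp => //; exact: measurable_quantizer.
Qed.

Lemma coupling_integral_fst mu nu (pi : probability (X * X)%type R)
    (f : X -> \bar R) : coupling mu nu pi ->
  measurable_fun setT f -> (forall x, 0 <= f x)%E ->
  (\int[pi]_z f z.1 = \int[mu]_x f x)%E.
Proof.
move=> cpl mf f0.
rewrite -[LHS](ge0_integral_pushforward (phi := fst) _ _ measurableT mf)//.
apply: eq_measure_integral => A mA _.
rewrite /= /pushforward (_ : _ @^-1` _ = A `*` setT); first by case: (cpl _ mA).
by apply/seteqP; split => [z|z []].
Qed.

Lemma coupling_integral_snd mu nu (pi : probability (X * X)%type R)
    (f : X -> \bar R) : coupling mu nu pi ->
  measurable_fun setT f -> (forall x, 0 <= f x)%E ->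
  (\int[pi]_z f z.2 = \int[nu]_x f x)%E.
Proof.
move=> cpl mf f0.
rewrite -[LHS](ge0_integral_pushforward (phi := snd) _ _ measurableT mf)//.
apply: eq_measure_integral => A mA _.
rewrite /= /pushforward (_ : _ @^-1` _ = setT `*` A); first by case: (cpl _ mA).
by apply/seteqP; split => [z|z []].
Qed.

Lemma integral_cells (pi : probability (X * X)%type R) (D : I -> I -> R) :
  (forall a b, 0 <= D a b) ->
  (\int[pi]_z (D (idx z.1) (idx z.2))%:E)%E =
  (\sum_a \sum_b fine (pi (cell idx a `*` cell idx b)) * D a b)%:E.
Proof.
move=> D0; rewrite pair_bigA -sumEFin/=.
have mC (c : I * I) : measurable (cell idx c.1 `*` cell idx c.2).
  exact: measurableX.
transitivity (\int[pi]_z \sum_(c : I * I)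
   (D c.1 c.2)%:E * (\1_(cell idx c.1 `*` cell idx c.2) z)%:E)%E.
  apply: eq_integral => z _; rewrite (bigD1 (idx z.1, idx z.2))//= big1 ?adde0.
    by rewrite indicE mem_set ?mule1.
  move=> [a b] abz; rewrite indicE memNset ?mule0// => -[/= za zb].
  by move: abz; rewrite za zb eqxx.
rewrite ge0_integral_sum//.
- apply: eq_bigr => c _; rewrite ge0_integralZl//.
  + by rewrite integral_indic// setIT EFinM fineK ?fin_num_measure// muleC.
  + by apply/measurable_EFinP; exact: measurable_indic.
  + by rewrite lee_fin.
- move=> c; apply: emeasurable_funM => //.
  by apply/measurable_EFinP; exact: measurable_indic.
- by move=> c z _; rewrite mule_ge0// lee_fin.
Qed.

Let cost (pi : probability (X * X)%type R) :=
  (\int[pi]_z (dist z.1 z.2)%:E)%E.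
Let qcost (pi : probability (X * X)%type R) :=
  (\sum_a \sum_b fine (pi (cell idx a `*` cell idx b)) * dist (p a) (p b))%:E.

Let measurable_qcost :
  measurable_fun setT (fun z : X * X => (dist (p (idx z.1)) (p (idx z.2)))%:E).
Proof.
by apply: measurable_dist_comp => //; apply: (measurableT_comp measurable_quantizer).
Qed.

Let measurable_cost : measurable_fun setT (fun z : X * X => (dist z.1 z.2)%:E).
Proof. exact: measurable_dist_comp. Qed.

(** The outer terms depend on one coordinate each, so they integrate to the quantization errors of
    the marginals. *)
Let integral_sum3 mu nu pi (f : X * X -> \bar R) : coupling mu nu pi ->
  measurable_fun setT f -> (forall z, 0 <= f z)%E ->
  (\int[pi]_z ((dist z.1 (p (idx z.1)))%:E + f z + (dist z.2 (p (idx z.2)))%:E) =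
   quantization_error mu + \int[pi]_z f z + quantization_error nu)%E.
Proof.
move=> cpl mf f0.
have m1 : measurable_fun setT (fun z : X * X => (dist z.1 (p (idx z.1)))%:E).
  exact: (measurableT_comp measurable_quantization_error).
have m2 : measurable_fun setT (fun z : X * X => (dist z.2 (p (idx z.2)))%:E).
  exact: (measurableT_comp measurable_quantization_error).
have e0 x : (0 <= (dist x (p (idx x)))%:E)%E by rewrite lee_fin metric_ge0.
rewrite ge0_integralD//; last 2 first.
  by move=> z _; rewrite adde_ge0.
  exact: emeasurable_funD.
rewrite ge0_integralD//.
congr (_ + _ + _)%E.
  exact: (coupling_integral_fst cpl measurable_quantization_error).
exact: (coupling_integral_snd cpl measurable_quantization_error).
Qed.

(** Triangle inequality through the centres of both cells, integrated against [pi]. The converse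
    bound goes from centre to centre through the two points. *)
Lemma cost_le_quantized mu nu pi : coupling mu nu pi ->
  (cost pi <= quantization_error mu + qcost pi + quantization_error nu)%E.
Proof.
move=> cpl; rewrite /qcost -(integral_cells pi (D := fun a b => dist (p a) (p b))).
  rewrite -integral_sum3//; last by move=> z; rewrite lee_fin metric_ge0.
  apply: ge0_le_integral => //.
  - by move=> z _; rewrite lee_fin metric_ge0.
  - apply: emeasurable_funD; last exact: (measurableT_comp measurable_quantization_error).
    apply: emeasurable_funD => //; exact: (measurableT_comp measurable_quantization_error).
  - move=> z _; rewrite -!EFinD lee_fin.
    rewrite (le_trans (metric_triangle dist_metric (p (idx z.2)) _ _))//.
    rewrite (metric_sym dist_metric _ z.2) lerD2r.
    exact: metric_triangle.
by move=> a b; exact: metric_ge0.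
Qed.

Lemma quantized_le_cost mu nu pi : coupling mu nu pi ->
  (qcost pi <= quantization_error mu + cost pi + quantization_error nu)%E.
Proof.
move=> cpl; rewrite /qcost -(integral_cells pi (D := fun a b => dist (p a) (p b))).
  rewrite -integral_sum3//; last by move=> z; rewrite lee_fin metric_ge0.
  apply: ge0_le_integral => //.
  - by move=> z _; rewrite lee_fin metric_ge0.
  - apply: emeasurable_funD; last exact: (measurableT_comp measurable_quantization_error).
    apply: emeasurable_funD => //; exact: (measurableT_comp measurable_quantization_error).
  - move=> z _; rewrite -!EFinD lee_fin.
    rewrite (le_trans (metric_triangle dist_metric z.2 _ _))// lerD2r.
    rewrite (le_trans (metric_triangle dist_metric z.1 _ _))// lerD2r.
    by rewrite (metric_sym dist_metric).
by move=> a b; exact: metric_ge0.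
Qed.

(** The cell masses of any coupling of [mu] and [nu] are moved to those of [mu'] and [nu'] and
    realized by a coupling. Passing to quantized costs and back adds [2 * k] each way, hence
    [4 * k]; each marginal moves by at most [#|I| * c] in l1. *)
Lemma W1_quantized_stability mu nu mu' nu' (k c Dm : R) :
  (quantization_error mu <= k%:E)%E -> (quantization_error nu <= k%:E)%E ->
  (quantization_error mu' <= k%:E)%E -> (quantization_error nu' <= k%:E)%E ->
  (forall a b, dist (p a) (p b) <= Dm) ->
  (forall a, `|fine (mu (cell idx a)) - fine (mu' (cell idx a))| <= c) ->
  (forall a, `|fine (nu (cell idx a)) - fine (nu' (cell idx a))| <= c) ->
  (W1 dist mu' nu' <=
   W1 dist mu nu + (4 * k + Dm * (2 * #|I|%:R * c))%:E)%E.
Proof.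
move=> emu enu emu' enu' distDm cmu cnu.
rewrite -leeBlDr//; apply: le_ereal_inf_tmp => _ [pi cpl <-].
rewrite leeBlDr//.
have rowsum a : \sum_b fine (pi (cell idx a `*` cell idx b)) =
    fine (mu (cell idx a)).
  have mc b : measurable (cell (idx \o snd) b : set (X * X)).
    rewrite (_ : cell _ _ = setT `*` cell idx b); first by apply: measurableX.
    by apply/seteqP; split => [z|z []].
  have mr : measurable (cell idx a `*` [set: X]) by apply: measurableX.
  rewrite -(proj1 (cpl _ (measurable_cell a))) (measure_cells mc pi mr).
  rewrite -sum_fine => [|b _]; last by rewrite fin_num_measure//; exact: measurableI.
  apply: eq_bigr => b _; congr (fine (pi _)).
  by apply/seteqP; split => [z []|z [[]]].
have colsum b : \sum_a fine (pi (cell idx a `*` cell idx b)) =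
    fine (nu (cell idx b)).
  have mc a : measurable (cell (idx \o fst) a : set (X * X)).
    rewrite (_ : cell _ _ = cell idx a `*` setT); first by apply: measurableX.
    by apply/seteqP; split => [z|z []].
  have mr : measurable ([set: X] `*` cell idx b) by apply: measurableX.
  rewrite -(proj2 (cpl _ (measurable_cell b))) (measure_cells mc pi mr).
  rewrite -sum_fine => [|a _]; last by rewrite fin_num_measure//; exact: measurableI.
  apply: eq_bigr => a _; congr (fine (pi _)).
  by apply/seteqP; split => [z []|z [[]]].
have [M' [M'0 M'r M'c M'D]] := transport_matrix_perturbation
  (D := fun a b => dist (p a) (p b)) (Dm := Dm)
  (fun a b => fine_ge0 (measure_ge0 pi (cell idx a `*` cell idx b)))
  rowsum colsum (sum_cells measurable_cell mu)
  (fun a => fine_ge0 (measure_ge0 mu' (cell idx a)))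
  (fun b => fine_ge0 (measure_ge0 nu' (cell idx b)))
  (sum_cells measurable_cell mu') (sum_cells measurable_cell nu')
  (fun a b => introT andP (conj (metric_ge0 dist_metric (p a) (p b)) (distDm a b))).
have [pi' cpl' pi'M] := coupling_with_cell_masses measurable_cell M'0 M'r M'c.
have Dm0 : 0 <= Dm.
  exact: le_trans (metric_ge0 dist_metric _ _) (distDm (idx point) (idx point)).
have sumc (F : I -> R) : (forall a, F a <= c) -> \sum_a F a <= #|I|%:R * c.
  by move=> Fc; rewrite mulr_natl -sumr_const ler_sum.
apply: (@le_trans _ _ (cost pi')).
  by apply: ereal_inf_lbound; exists pi'.
apply: (le_trans (cost_le_quantized cpl')).
have qpi' : (qcost pi' <= qcost pi + (Dm * (2 * #|I|%:R * c))%:E)%E.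
  rewrite /qcost -EFinD lee_fin.
  under eq_bigr do under eq_bigr do rewrite pi'M /=.
  rewrite (le_trans M'D)// lerD2l ler_wpM2l//.
  rewrite -mulrA mulr_natl mulr2n lerD//; exact: sumc.
apply: (@le_trans _ _ (k%:E + (k%:E + cost pi + k%:E +
    (Dm * (2 * #|I|%:R * c))%:E) + k%:E)%E).
  rewrite leeD// leeD//; apply: (le_trans qpi'); rewrite leeD2r//.
  by apply: (le_trans (quantized_le_cost cpl)); rewrite leeD// leeD.
rewrite -/(cost pi) le_eqVlt; apply/orP; left; apply/eqP.
(* The cost may be [+oo]; nonnegativity excludes [-oo], after which the constants can be
   regrouped. *)
have := integral_ge0 pi (D := setT) (f := fun z => (dist z.1 z.2)%:E).
rewrite -/(cost pi); case: (cost pi) => [r _|//|/(_ _)]; last first.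
  by move=> H; have := H (fun z _ => metric_ge0 dist_metric z.1 z.2).
by rewrite -!EFinD; congr EFin; ring.
Qed.

End Quantization.

(** * Existence of fine finite quantizers *)

Section QuantizerExistence.
Context {R : realType} {d : measure_display} {X : measurableType d}.
Variable dist : X -> X -> R.
Hypothesis dist_metric : is_metric dist.
Hypothesis dist_separable : metric_separable dist.
Hypothesis borel : @measurable _ X = <<s metric_open dist >>.

Section LastNear.
Variables (s : nat -> X) (delta : R).

(* One plus the largest n < K such that s n is delta-close to x; 0 if none. *)
Fixpoint last_near (K : nat) (x : X) : nat :=
  if K is K'.+1 then
    if dist (s K') x < delta then K'.+1 else last_near K' x
  else 0%N.

Lemma last_near_lt K x : (last_near K x < K.+1)%N.
Proof. by elim: K => //= K IH; case: ifP => // _; exact: ltnW. Qed.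

Lemma last_near_close K x n : last_near K x = n.+1 -> dist x (s n) < delta.
Proof.
elim: K => //= K IH; case: ifPn => // + [<-].
by rewrite (metric_sym dist_metric).
Qed.

Lemma last_near_far K x n : last_near K x = 0%N -> (n < K)%N ->
  delta <= dist x (s n).
Proof.
elim: K => //= K IH; case: ltP => // far K0.
rewrite ltnS leq_eqVlt => /predU1P[->|]; last exact: IH.
by rewrite (metric_sym dist_metric).
Qed.

Lemma measurable_last_near K : measurable_fun setT (last_near K).
Proof.
elim: K => [|K IH] /=; first exact: measurable_cst.
apply: measurable_fun_ifT => //.
apply: measurable_fun_ltr => //.
exact: measurable_dist_from.
Qed.

End LastNear.

(** A point goes to a [delta]-close term among the first [K] of the dense sequence, and to [y0] if
    there is none. The error from the second case is dominated by [dist x y0] and tends to 0 as [K]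
    grows; one [K] serves the finitely many laws. *)
Lemma quantizer_exists (I0 : finType) (P : I0 -> probability X R) (y0 : X)
    (eps : R) :
  (forall i, \int[P i]_y (dist y y0)%:E < +oo)%E -> 0 < eps ->
  exists (m : nat) (idx : X -> 'I_m.+1) (p : 'I_m.+1 -> X),
    (forall a, measurable (cell idx a)) /\
    (forall i, quantization_error dist idx p (P i) <= eps%:E)%E.
Proof.
move=> Poo eps0.
have [/(_ point)//|[s sd]] := dist_separable.
pose delta := eps / 2; have delta0 : 0 < delta by rewrite divr_gt0.
(* Same shift as in [last_near]: index 0 means that no term is close. *)
pose pt n := if n is n'.+1 then s n' else y0.
pose h K x := if last_near s delta K x == 0%N then dist x y0 else 0.
have md0 : measurable_fun setT (fun x => dist x y0).
  apply: (eq_measurable_fun (dist y0)); last exact: measurable_dist_from.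
  by move=> x _; rewrite (metric_sym dist_metric).
have mh K : measurable_fun setT (h K).
  apply: measurable_fun_ifT => //.
  have := measurableT_comp (f := fun n : nat => n == 0%N) _ (measurable_last_near s delta K).
  by apply.
have hlim i : (\int[P i]_x (h K x)%:E @[K --> \oo] --> 0)%E.
  rewrite -(integral0 (P i) setT).
  apply: (@dominated_cvg _ _ _ _ _ measurableT _ _ (fun x => (dist x y0)%:E)) => //.
  - by move=> K; apply/measurable_EFinP.
  (* Pointwise limit: once [K] exceeds the index of a term close to [x], [h K x] is 0. *)
  - move=> x _; have [n xn] := sd x _ delta0.
    apply: cvg_near_cst; exists n.+1 => // K /= nK; rewrite /h.
    case: eqP => // K0.
    by have := last_near_far K0 nK; rewrite leNgt xn.
  - apply/integrableP; split; first exact/measurable_EFinP.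
    rewrite (eq_integral (fun x => (dist x y0)%:E)) => [|x _]; first exact: Poo.
    by rewrite /= ger0_norm// metric_ge0.
  - move=> K x _; rewrite lee_fin /h; case: ifP => _; last by rewrite normr0 metric_ge0.
    by rewrite ger0_norm// metric_ge0.
have /choice[N NP] : forall i, exists N, forall K, (N <= K)%N ->
    (\int[P i]_x (h K x)%:E <= delta%:E)%E.
  move=> i.
  have nb : nbhs (0%E : \bar R) [set y | (y < delta%:E)%E].
    by apply: open_ereal_lt'; rewrite lte_fin.
  have [N _ NP] := hlim i _ nb.
  by exists N => K NK; apply: ltW; exact: NP.
pose K := (\max_i N i)%N.
exists K, (fun x => inord (last_near s delta K x)), (fun a => pt a); split.
  move=> a; rewrite (_ : cell _ _ = last_near s delta K @^-1` [set (a : nat)]).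
    by rewrite -[X in measurable X]setTI; exact: measurable_last_near.
  apply/seteqP; split => x /=; first by move=> <-; rewrite inordK// last_near_lt.
  by rewrite /cell /= => ->; rewrite inord_val.
move=> i; rewrite /quantization_error.
apply: (@le_trans _ _ (\int[P i]_x (delta%:E + (h K x)%:E))%E).
  apply: ge0_le_integral => //.
  - by move=> x _; rewrite lee_fin metric_ge0.
  - apply: (measurable_dist_comp dist_metric dist_separable borel) => //.
    apply: (measurableT_comp (f := fun n => pt (inord n : 'I_K.+1))) => //.
    exact: measurable_last_near.
  - apply: emeasurable_funD => //; exact/measurable_EFinP.
  - move=> x _; rewrite inordK ?last_near_lt// -EFinD lee_fin /h.
    case E : (last_near s delta K x) => [|n] /=; first by rewrite lerDr ltW.
    by rewrite addr0 ltW// (last_near_close E).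
rewrite ge0_integralD//; last 3 first.
  by move=> x _; rewrite lee_fin ltW.
  by move=> x _; rewrite lee_fin /h; case: ifP => // _; exact: metric_ge0.
  exact/measurable_EFinP.
rewrite integral_cst// [X in (_ * X)%E](_ : _ = 1%E); last exact: probability_setT.
rewrite mule1 [eps]splitr EFinD leeD//.
by apply: NP; exact: leq_bigmax.
Qed.

End QuantizerExistence.

(** * Concentration of empirical measures *)

Section EventuallySmall.
Context {R : realType} {dO : measure_display} {Omega : measurableType dO}.
Variable Pr : probability Omega R.

(** The sets [E N] need not be measurable: their outer probability is bounded through a measurable
    superset, as in [cvg_in_outer_prob]. *)
Definition eventually_small (E : nat -> set Omega) (kappa : R) :=
  exists N0, forall N, (N0 <= N)%N ->
    exists2 B : set Omega, measurable B /\ E N `<=` B & (Pr B <= kappa%:E)%E.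

Lemma eventually_smallU E E' kappa kappa' :
  eventually_small E kappa -> eventually_small E' kappa' ->
  eventually_small (fun N => E N `|` E' N) (kappa + kappa').
Proof.
move=> [N0 H] [N0' H']; exists (maxn N0 N0') => N; rewrite geq_max => /andP[h h'].
have [B [mB EB] PB] := H _ h; have [B' [mB' EB'] PB'] := H' _ h'.
exists (B `|` B').
  by split; [exact: measurableU|exact: setUSS].
by rewrite EFinD (le_trans (measureU2 _ mB mB'))// leeD.
Qed.

Lemma eventually_small_bigcup (I : finType) (E : I -> nat -> set Omega) kappa :
  (forall i, eventually_small (E i) kappa) ->
  eventually_small (fun N => \bigcup_i E i N) (#|I|%:R * kappa).
Proof.
move=> /choice[N0 H]; exists (\max_i N0 i)%N => N maxN.
have {}H i : exists B, [/\ measurable B, E i N `<=` B & (Pr B <= kappa%:E)%E].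
  have iN : (N0 i <= N)%N by apply: leq_trans maxN; exact: leq_bigmax.
  by have [B [? ?] ?] := H i _ iN; exists B.
have /choice[B BP] := H.
exists (\big[setU/set0]_i B i).
  split; first by apply: bigsetU_measurable => i _; case: (BP i).
  move=> w [i _ Ei]; rewrite -bigcup_seq; exists i => /=.
    by rewrite mem_index_enum.
  by case: (BP i) => _ + _; apply.
rewrite mulr_natl -sumr_const -sumEFin.
suff [] : measurable (\big[setU/set0]_i B i) /\
  (Pr (\big[setU/set0]_i B i) <= \sum_(i in I) kappa%:E)%E by [].
elim/big_rec2: _ => [|i s U _ [mU PU]]; first by rewrite measure0.
have [mB _ PB] := BP i; split; first exact: measurableU.
by rewrite (le_trans (measureU2 _ mB mU))// leeD.
Qed.

(** The inclusion is asked for [0 < N] only, where empirical measures are probabilities. *)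
Lemma eventually_small_sub E E' kappa kappa' :
  (forall N, (0 < N)%N -> E N `<=` E' N) -> kappa' <= kappa ->
  eventually_small E' kappa' -> eventually_small E kappa.
Proof.
move=> EE' kk [N0 H]; exists N0.+1 => N NN.
have [B [mB EB] PB] := H _ (ltnW NN); exists B.
  by split=> //; apply: subset_trans EB; apply: EE'; exact: leq_ltn_trans NN.
by apply: (le_trans PB); rewrite lee_fin.
Qed.

(** Integrate the inequality [t * \1_B w <= g w], where [B] is the set on which [g] exceeds [t]. *)
Lemma markov_ge0 (g : Omega -> R) (t kappa : R) : measurable_fun setT g ->
  (forall w, 0 <= g w) -> 0 < t -> (\int[Pr]_w (g w)%:E <= (t * kappa)%:E)%E ->
  exists2 B : set Omega, measurable B /\ [set w | t < g w] `<=` B &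
    (Pr B <= kappa%:E)%E.
Proof.
move=> mg g0 t0 intg.
have mB : measurable [set w | t < g w].
  have := measurable_fun_ltr (measurable_cst t) mg measurableT.
  by move=> /(_ [set true] I); rewrite setTI.
exists [set w | t < g w]; first by split.
rewrite -(@lee_pmul2l _ t%:E)// -EFinM; apply: le_trans intg.
rewrite -[X in Pr X]setIT -integral_indic// -ge0_integralZl//; last 2 first.
- by apply/measurable_EFinP; exact: measurable_indic.
- by rewrite lee_fin ltW.
apply: ge0_le_integral => //.
- by move=> w _; rewrite mule_ge0// lee_fin// ltW.
- apply: emeasurable_funM => //.
  by apply/measurable_EFinP; exact: measurable_indic.
- exact/measurable_EFinP.
- move=> w _; rewrite -EFinM lee_fin indicE; case: (boolP (w \in _)) => [/set_mem/= /ltW|_].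
    by rewrite mulr1.
  by rewrite mulr0.
Qed.

End EventuallySmall.

Section EmpiricalMeasures.
Context {R : realType} {d : measure_display} {X : measurableType d}.
Context {dO : measure_display} {Omega : measurableType dO}.
Variables (Pr : probability Omega R) (Z : nat -> Omega -> X) (P : probability X R).
Hypothesis iid : iid_with_law Pr Z P.

(** An empirical measure is the uniform mixture of Dirac masses at the sample points, so its
    integrals are sample means. *)
Lemma empirical_probability N w : (0 < N)%N ->
  exists q : probability X R, (forall A, empirical N Z w A = q A) /\
    (forall f : X -> R, measurable_fun setT f -> (forall x, 0 <= f x) ->
      (\int[q]_x (f x)%:E = ((\sum_(k < N) f (Z k w)) / N%:R)%:E)%E).
Proof.
move=> N0.
have l0 (k : 'I_N) : 0 <= N%:R^-1 :> R by [].
have l1 : \sum_(k < N) N%:R^-1 = 1 :> R.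
  by rewrite sumr_const card_ord -[_ *+ N]mulr_natr mulVf// pnatr_eq0 -lt0n.
have [q [qE qint]] :=
  finite_mixture_exists (fun k : 'I_N => \d_(Z k w) : probability X R) l0 l1.
exists q; split => [A|f mf f0].
  by rewrite qE /empirical ge0_sume_distrr.
rewrite qint; [|exact/measurable_EFinP|by move=> x; rewrite lee_fin].
rewrite mulr_suml -sumEFin; apply: eq_bigr => k _.
rewrite integral_dirac//; last exact/measurable_EFinP.
by rewrite diracT mul1e -EFinM mulrC.
Qed.

Lemma integral_sample (f : X -> R) k : measurable_fun setT f ->
  (forall x, 0 <= f x) ->
  (\int[Pr]_w (f (Z k w))%:E = \int[P]_x (f x)%:E)%E.
Proof.
case: iid => mZ lawZ _ mf f0.
have mf' : measurable_fun setT (EFin \o f) by exact/measurable_EFinP.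
rewrite -[LHS](ge0_integral_pushforward (mZ k) _ measurableT mf')//; last first.
  by move=> x _; rewrite lee_fin.
by apply: eq_measure_integral => A mA _; rewrite /= /pushforward lawZ.
Qed.

(** Markov's inequality, the sample mean having the integral of [f] under [P] as expectation.
    Applied to the distance to the cell centre, it controls the quantization error of the empirical
    measure. *)
Lemma sample_mean_small (f : X -> R) (t kappa : R) : measurable_fun setT f ->
  (forall x, 0 <= f x) -> 0 < t -> (\int[P]_x (f x)%:E <= (t * kappa)%:E)%E ->
  eventually_small Pr (fun N => [set w | t < (\sum_(k < N) f (Z k w)) / N%:R])
    kappa.
Proof.
move=> mf f0 t0 intf; exists 1%N => N N0; apply: markov_ge0 => //.
- apply: measurable_funM => //; apply: measurable_sum => k.
  by apply: measurableT_comp mf _; case: iid.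
- by move=> w; rewrite divr_ge0// sumr_ge0.
have mfZ k : measurable_fun setT (fun w => (f (Z k w))%:E).
  by apply/measurable_EFinP; apply: measurableT_comp mf _; case: iid.
rewrite (eq_integral (fun w => N%:R^-1%:E * \sum_(k < N) (f (Z k w))%:E)%E);
  last by move=> w _; rewrite sumEFin -EFinM mulrC.
rewrite ge0_integralZl//; last 2 first.
- exact: emeasurable_sum.
- by move=> w _; apply: sume_ge0 => k _; rewrite lee_fin.
rewrite ge0_integral_sum//; last by move=> k w _; rewrite lee_fin.
under eq_bigr do rewrite integral_sample//.
have [i iE] : exists i, (\int[P]_x (f x)%:E)%E = i%:E.
  exists (fine (\int[P]_x (f x)%:E)%E); rewrite fineK//.
  rewrite ge0_fin_numE ?(le_lt_trans intf) ?ltry//.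
  by apply: integral_ge0 => x _; rewrite lee_fin.
rewrite iE sumEFin -EFinM sumr_const card_ord -[i *+ N]mulr_natr mulrCA mulVf ?mulr1.
  by rewrite -iE.
by rewrite pnatr_eq0 -lt0n.
Qed.

End EmpiricalMeasures.

(** * Chebyshev's inequality for cell frequencies *)

Section FrequencyConcentration.
Context {R : realType} {dO : measure_display} {Omega : measurableType dO}.
Variables (Pr : probability Omega R) (A : nat -> set Omega) (p : R).
Hypothesis mA : forall k, measurable (A k).
Hypothesis PrA : forall k, Pr (A k) = p%:E.
Hypothesis indepA : forall k l, k != l -> Pr (A k `&` A l) = (p * p)%:E.

Let S N w : R := \sum_(k < N) \1_(A k) w.

Let measurable_S N : measurable_fun setT (S N).
Proof. by apply: measurable_sum => k; exact: measurable_indic. Qed.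

Let integral_S N : (\int[Pr]_w (S N w)%:E = (N%:R * p)%:E)%E.
Proof.
rewrite (eq_integral (fun w => \sum_(k < N) (\1_(A k) w)%:E)%E); last first.
  by move=> w _; rewrite sumEFin.
rewrite ge0_integral_sum//; last first.
  by move=> k; apply/measurable_EFinP; exact: measurable_indic.
transitivity (\sum_(k < N) p%:E)%E.
  by apply: eq_bigr => k _; rewrite integral_indic// setIT; exact: PrA.
by rewrite sumEFin sumr_const card_ord mulr_natl.
Qed.

(** The square expands over pairs of indices: [N] diagonal pairs contribute [p] each, the other
    [N * (N - 1)] contribute [p * p] by independence. *)
Let integral_S2 N :
  (\int[Pr]_w (S N w ^+ 2)%:E = (N%:R * p + N%:R * (N%:R - 1) * (p * p))%:E)%E.
Proof.
rewrite (eq_integral (fun w => \sum_(c : 'I_N * 'I_N)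
    (\1_(A c.1 `&` A c.2) w)%:E)%E); last first.
  move=> w _; rewrite sumEFin; congr EFin.
  rewrite /S expr2 big_distrlr/= pair_bigA/=; apply: eq_bigr => c _.
  by rewrite indicI.
rewrite ge0_integral_sum//; last first.
  move=> c; apply/measurable_EFinP; apply: measurable_indic.
  exact: measurableI.
transitivity (\sum_(c : 'I_N * 'I_N)
  (if c.1 == c.2 then p else p * p)%:E)%E.
  apply: eq_bigr => c _; rewrite integral_indic//; last exact: measurableI.
  rewrite setIT; case: eqP => [->|/eqP cc]; last exact: indepA.
  by rewrite setIid; exact: PrA.
rewrite sumEFin; congr EFin.
rewrite -(pair_bigA _ (fun a b : 'I_N => if a == b then p else p * p))/=.
transitivity (\sum_(a < N) (p + (N%:R - 1) * (p * p))).
  apply: eq_bigr => a _; rewrite (bigD1 a)//= eqxx; congr (_ + _).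
  rewrite (eq_bigr (fun=> p * p)); last first.
    by move=> b; rewrite eq_sym => /negPf ->.
  rewrite sumr_const (_ : #|_| = N.-1); last first.
    by rewrite cardC1 card_ord.
  rewrite -[LHS]mulr_natl; congr (_ * _).
  by rewrite -subn1 natrB// (leq_ltn_trans _ (ltn_ord a)).
by rewrite sumr_const card_ord -[LHS]mulr_natl mulrDr mulrA.
Qed.

Lemma frequency_variance N :
  (\int[Pr]_w ((S N w - N%:R * p) ^+ 2)%:E = (N%:R * (p - p * p))%:E)%E.
Proof.
have p0 : 0 <= p by rewrite -lee_fin -(PrA 0).
have S0 w : 0 <= S N w by rewrite sumr_ge0.
have m1 : measurable_fun setT (fun w => ((S N w - N%:R * p) ^+ 2)%:E).
  by apply/measurable_EFinP; apply: measurable_funX; apply: measurable_funB.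
have m2 : measurable_fun setT (fun w => (2 * (N%:R * p) * S N w)%:E).
  by apply/measurable_EFinP; apply: measurable_funM.
(* The cross term is moved to the side of the variance, so that all integrands are nonnegative and
   integrals add up. *)
have : (\int[Pr]_w (((S N w - N%:R * p) ^+ 2)%:E + (2 * (N%:R * p) * S N w)%:E) =
  \int[Pr]_w ((S N w ^+ 2)%:E + ((N%:R * p) ^+ 2)%:E))%E.
  by apply: eq_integral => w _; rewrite -!EFinD; congr EFin; ring.
have c0 : 0 <= 2 * (N%:R * p) by rewrite !mulr_ge0.
rewrite ge0_integralD//; last 2 first.
- by move=> w _; rewrite lee_fin sqr_ge0.
- by move=> w _; rewrite lee_fin mulr_ge0.
rewrite ge0_integralD//; last 3 first.
- by move=> w _; rewrite lee_fin sqr_ge0.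
- by apply/measurable_EFinP; apply: measurable_funX.
- by move=> w _; rewrite lee_fin sqr_ge0.
rewrite integral_S2 integral_cst// [X in (_ * X)%E](_ : _ = 1%E); last first.
  exact: probability_setT.
under [X in (_ + X)%E]eq_integral do rewrite EFinM.
rewrite ge0_integralZl//; last 2 first.
- exact/measurable_EFinP.
- by move=> w _; rewrite lee_fin.
rewrite integral_S mule1 -!EFinM -EFinD.
case: (\int[Pr]_w _)%E => [r||] //; rewrite -EFinD => -[] h.
by congr EFin; lra.
Qed.

Lemma frequency_concentration (c kappa : R) : 0 < c -> 0 < kappa ->
  eventually_small Pr (fun N => [set w | c < `|S N w / N%:R - p|]) kappa.
Proof.
move=> c0 kappa0.
have p0 : 0 <= p by rewrite -lee_fin -(PrA 0).
(* From this rank on [1 <= c ^+ 2 * kappa * N%:R], so the variance, at most [N%:R], is at most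
   [(c * N%:R) ^+ 2 * kappa]. *)
exists (Num.truncn (c ^+ 2 * kappa)^-1).+1 => N NN.
have N0 : 0 < N%:R :> R by rewrite ltr0n (leq_ltn_trans _ NN).
have [||||B [mB sB] PB] := @markov_ge0 _ _ _ Pr (fun w => (S N w - N%:R * p) ^+ 2)
   ((c * N%:R) ^+ 2) kappa.
- by apply: measurable_funX; apply: measurable_funB.
- by move=> w; rewrite sqr_ge0.
- by rewrite exprn_gt0// mulr_gt0.
- rewrite frequency_variance lee_fin.
  have : 1 <= c ^+ 2 * kappa * N%:R.
    rewrite -ler_pdivrMl ?mulr1; last by rewrite mulr_gt0// exprn_gt0.
    apply: ltW; apply: lt_le_trans (truncnS_gt _) _; last by rewrite ler_nat.
  have : p * (1 - p) <= 1 by nra.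
  move=> pp h; rewrite exprMn.
  have -> : c ^+ 2 * N%:R ^+ 2 * kappa = N%:R * (c ^+ 2 * kappa * N%:R) by ring.
  rewrite ler_wpM2l ?ltW//; nra.
exists B => //; split => // w /= h; apply: sB => /=.
have {}h : c * N%:R < `|S N w - N%:R * p|.
  rewrite (_ : S N w - _ = (S N w / N%:R - p) * N%:R); last first.
    by rewrite mulrBl divfK ?gt_eqF// (mulrC p).
  by rewrite normrM (gtr0_norm N0) ltr_pM2r.
by rewrite -(real_normK (num_real (S N w - _))) ltr_pXn2r// nnegrE mulr_ge0// ltW.
Qed.

End FrequencyConcentration.

(** * Convexity of the objective *)

Section EntropyConvexity.
Context {R : realType}.

(* Square roots turn ln t <= t - 1 into the Hellinger-type gain
   (sqrt x - sqrt m)^2 over the tangent line of x ln x at m. *)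
Lemma xlogx_ge_tangent (x m : R) : 0 <= x <= 1 -> 0 < m <= 1 ->
  x * ln m + (x - m) + (x - m) ^+ 2 / 4 <= xlogx x.
Proof.
move=> /andP[x0 x1] /andP[m0 m1]; rewrite /xlogx; case: eqP => [->|/eqP xn0].
  by nra.
have {x0 xn0}xp : 0 < x by rewrite lt_def xn0.
set a := Num.sqrt x; set b := Num.sqrt m.
have a0 : 0 < a by rewrite sqrtr_gt0.
have b0 : 0 < b by rewrite sqrtr_gt0.
have a1 : a <= 1 by rewrite -(sqrtr1 R) ler_sqrt.
have b1 : b <= 1 by rewrite -(sqrtr1 R) ler_sqrt.
have xa : x = a * a by rewrite -expr2 sqr_sqrtr// ltW.
have mb : m = b * b by rewrite -expr2 sqr_sqrtr// ltW.
have lnba : ln b - ln a <= b / a - 1.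
  rewrite -ln_div ?posrE//.
  have := @le_ln1Dx R (b / a - 1); rewrite [1 + _]addrC subrK; apply.
  by rewrite ltrBrDl subrr divr_gt0.
have key : a * (ln b - ln a) <= b - a.
  apply: le_trans (ler_wpM2l (ltW a0) lnba) _.
  by rewrite mulrBr mulr1 mulrCA divff ?gt_eqF// mulr1.
rewrite [in ln x]xa [in ln m]mb !lnM ?posrE// xa mb.
have : a * (a * (ln b - ln a)) <= a * (b - a) by rewrite ler_wpM2l// ltW.
(* As [x - m = (a - b) * (a + b)] and [a + b <= 2], the gain [(a - b) ^+ 2] is at least
   [(x - m) ^+ 2 / 4]. *)
have : (a - b) ^+ 2 * ((a + b) ^+ 2 / 4) <= (a - b) ^+ 2.
  rewrite ler_piMr ?sqr_ge0//; nra.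
nra.
Qed.

(** Add the tangent bounds at the midpoint for [x] and [y]: the first-order terms cancel and the two
    gains sum to [(x - y) ^+ 2 / 8]. A zero midpoint, where there is no tangent, forces
    [x = y = 0]. *)
Lemma xlogx_midpoint (x y : R) : 0 <= x <= 1 -> 0 <= y <= 1 ->
  2 * xlogx ((x + y) / 2) + (x - y) ^+ 2 / 8 <= xlogx x + xlogx y.
Proof.
move=> x01 y01; have [/andP[x0 x1] /andP[y0 y1]] := (x01, y01).
have [m0|m0] := eqVneq ((x + y) / 2) 0.
  have -> : x = 0 by lra.
  have -> : y = 0 by lra.
  by rewrite addr0 mul0r subrr expr0n/= mul0r addr0 /xlogx eqxx mulr0 addr0.
have mp : 0 < (x + y) / 2 <= 1 by rewrite lt_def m0 /=; lra.
have := xlogx_ge_tangent x01 mp; have := xlogx_ge_tangent y01 mp.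
have -> : xlogx ((x + y) / 2) = (x + y) / 2 * ln ((x + y) / 2).
  by rewrite {1}/xlogx (negPf m0).
set l := ln _.
nra.
Qed.

End EntropyConvexity.

(** * Midpoint convexity of W1 and sharpness of the minimizer *)

Section ObjectiveConvexity.
Context {R : realType} {d : measure_display} {X : measurableType d}.
Variable dist : X -> X -> R.
Hypothesis dist_metric : is_metric dist.
Hypothesis dist_separable : metric_separable dist.
Hypothesis borel : @measurable _ X = <<s metric_open dist >>.
Variable J : nat.
Implicit Types (l : 'I_J -> R) (mus : 'I_J -> probability X R).

Local Notation mix l mus :=
  (mixture l (fun j => mus j : set X -> \bar R)).

Lemma W1_ge0 (mu nu : set X -> \bar R) : (0 <= W1 dist mu nu)%E.
Proof.
apply: le_ereal_inf_tmp => _ [pi _ <-].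
by apply: integral_ge0 => z _; rewrite lee_fin metric_ge0.
Qed.

(** The half-and-half mixture of two couplings within [e] of optimal couples the averaged mixture
    with [nu], at the average cost; [e] is arbitrary. *)
Lemma W1_mixture_midpoint mus (nu : set X -> \bar R) l l' (w w' : R) :
  W1 dist (mix l mus) nu = w%:E -> W1 dist (mix l' mus) nu = w'%:E ->
  (W1 dist (mix (fun i => (l i + l' i) / 2)%R mus) nu <= ((w + w') / 2)%:E)%E.
Proof.
move=> Ww Ww'; apply/lee_addgt0Pr => e e0.
have [|_ [pi cpl <-]] := lb_ereal_inf_adherent (S := [set (\int[pi]_z (dist z.1 z.2)%:E)%E
   | pi in [set pi : probability (X * X)%type R | coupling (mix l mus) nu pi]]) e0.
  by rewrite -/(W1 dist (mix l mus) nu) Ww.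
rewrite -/(W1 dist (mix l mus) nu) Ww -EFinD => cost_pi.
have [|_ [pi' cpl' <-]] := lb_ereal_inf_adherent (S := [set (\int[pi]_z (dist z.1 z.2)%:E)%E
   | pi in [set pi : probability (X * X)%type R | coupling (mix l' mus) nu pi]]) e0.
  by rewrite -/(W1 dist (mix l' mus) nu) Ww'.
rewrite -/(W1 dist (mix l' mus) nu) Ww' -EFinD => cost_pi'.
have half0 (b : bool) : 0 <= 2^-1 :> R by [].
have half2 : 2^-1 + 2^-1 = 1 :> R by field.
have half1 : \sum_(b : bool) 2^-1 = 1 :> R by rewrite big_bool.
have [q [qE qint]] :=
  @finite_mixture_exists _ _ _ _ _ (fun b => if b then pi else pi') half0 half1.
have halfE (x : \bar R) : (0 <= x -> 2^-1%:E * x + 2^-1%:E * x = x)%E.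
  by move=> x0; rewrite -ge0_muleDl ?lee_fin// -EFinD half2 mul1e.
apply: (@le_trans _ _ (\int[q]_z (dist z.1 z.2)%:E)%E).
  apply: ereal_inf_lbound; exists q => // A mA; rewrite !qE !big_bool /=.
  have [-> ->] := cpl _ mA; have [-> nuA] := cpl' _ mA; split; last first.
    by rewrite nuA halfE// -nuA.
  have finE (k : 'I_J -> R) :
      mix k mus A = (\sum_(i < J) k i * fine (mus i A))%:E.
    rewrite /mixture -sumEFin; apply: eq_bigr => i _.
    by rewrite EFinM fineK// fin_num_measure.
  rewrite !finE -!EFinM -EFinD; congr EFin.
  rewrite !mulr_sumr -big_split/=; apply: eq_bigr => i _.
  by rewrite mulrDl mulrDl; congr (_ + _); ring.
rewrite qint; last 2 first.
  exact: measurable_dist_comp.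
  by move=> z; rewrite lee_fin metric_ge0.
rewrite big_bool /=.
apply: (@le_trans _ _ (2^-1%:E * (w + e)%:E + 2^-1%:E * (w' + e)%:E)%E).
  by rewrite leeD// lee_wpmul2l// ltW.
by rewrite -!EFinM -!EFinD (_ : _ + _ = (w + w') / 2 + e)//; field.
Qed.

(** The product coupling has finite cost: with a single cell centred at [y0], the quantization
    errors are the first moments and the quantized cost is finite. *)
Lemma W1_fin_num (mu nu : probability X R) y0 :
  (\int[mu]_y (dist y y0)%:E < +oo)%E -> (\int[nu]_y (dist y y0)%:E < +oo)%E ->
  W1 dist mu nu \is a fin_num.
Proof.
move=> muoo nuoo; rewrite ge0_fin_numE ?W1_ge0//.
have cpl : coupling mu nu (mu \x nu)%E.
  move=> A mA; split.
    rewrite [LHS]product_measure1E// -[RHS]mule1; congr (_ * _)%E.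
    exact: probability_setT.
  rewrite [LHS]product_measure1E// -[RHS]mul1e; congr (_ * _)%E.
  exact: probability_setT.
have mcell (a : unit) : measurable (cell (fun _ : X => tt) a).
  by rewrite (_ : cell _ _ = setT)// -subTset => x _; case: a.
apply: (@le_lt_trans _ _ (\int[(mu \x nu)%E]_z (dist z.1 z.2)%:E)%E).
  by apply: ereal_inf_lbound; exists (mu \x nu)%E.
apply: le_lt_trans
  (cost_le_quantized dist_metric dist_separable borel (fun _ => y0) mcell cpl) _.
by rewrite lte_add_pinfty// lte_add_pinfty// ltry.
Qed.

(** Let [S] be the sum of squares and [Q] the objective. Minimality at the midpoint and strong
    convexity give [Q lstar <= (Q l + Q lstar) / 2 - eta * S / 16]; inserting [Q l <= Q lstar + e]
    bounds [eta * S] by [8 * e]. *)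
Lemma near_argmin_close mus (nu : probability X R) (y0 : X) (eta e : R)
    (lstar l : 'I_J -> R) :
  0 < eta ->
  (\int[nu]_y (dist y y0)%:E < +oo)%E ->
  (forall j, \int[mus j]_y (dist y y0)%:E < +oo)%E ->
  is_argmin (objective dist eta (fun j => mus j : set X -> \bar R) nu) lstar ->
  @simplex R J l ->
  (objective dist eta (fun j => mus j : set X -> \bar R) nu l <=
   objective dist eta (fun j => mus j : set X -> \bar R) nu lstar + e%:E)%E ->
  eta * \sum_(i < J) (l i - lstar i) ^+ 2 <= 8 * e.
Proof.
move=> eta0 nuoo musoo [slstar amin] sl Ql.
have simplex01 l' (i : 'I_J) : @simplex R J l' -> 0 <= l' i <= 1.
  by move=> [l0 l1]; rewrite l0 -l1 (bigD1 i)//= lerDl sumr_ge0.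
have finW l' : @simplex R J l' -> W1 dist (mix l' mus) nu \is a fin_num.
  move=> [l0 l1].
  have [q [qE qint]] := finite_mixture_exists mus l0 l1.
  rewrite (_ : mix l' mus = q); last by apply/funext => A; rewrite qE.
  apply: (W1_fin_num (y0 := y0)) => //; rewrite qint; last 2 first.
    exact: measurable_dist_comp.
    by move=> z; rewrite lee_fin metric_ge0.
  apply: lte_sum_pinfty => j _; rewrite lte_mul_pinfty// ?lee_fin//.
have /fineK/esym Ww := finW _ sl; have /fineK/esym Ws := finW _ slstar.
set w := fine _ in Ww; set ws := fine _ in Ws.
pose mid i := (l i + lstar i) / 2.
have smid : @simplex R J mid.
  split => [i|]; first by rewrite divr_ge0// addr_ge0//; [case: sl|case: slstar].
  rewrite -mulr_suml big_split/=; case: sl => _ ->; case: slstar => _ ->.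
  by rewrite divff.
have Wm := W1_mixture_midpoint Ww Ws.
move: (amin _ smid) Ql; rewrite /objective Ww Ws -!EFinD lee_fin => Qmid Ql.
have {}Qmid : ((ws + eta * \sum_(i < J) xlogx (lstar i))%:E <=
   ((w + ws) / 2 + eta * \sum_(i < J) xlogx (mid i))%:E)%E.
  by apply: (le_trans Qmid); rewrite EFinD leeD2r.
move: Qmid; rewrite lee_fin => Qmid.
have conv : 2 * \sum_(i < J) xlogx (mid i) +
   (\sum_(i < J) (l i - lstar i) ^+ 2) / 8 <=
   \sum_(i < J) xlogx (l i) + \sum_(i < J) xlogx (lstar i).
  rewrite mulr_sumr mulr_suml -!big_split/=; apply: ler_sum => i _.
  by apply: xlogx_midpoint; exact: simplex01.
move: conv => /(ler_wpM2l (ltW eta0)); lra.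
Qed.

End ObjectiveConvexity.

(** * Consistency of the empirical minimizer *)

Section Consistency.
Context {R : realType} {d : measure_display} {X : measurableType d}.
Variable dist : X -> X -> R.
Hypothesis dist_metric : is_metric dist.
Hypothesis dist_separable : metric_separable dist.
Hypothesis borel : @measurable _ X = <<s metric_open dist >>.
Context {I : finType} (idx : X -> I) (p : I -> X).
Hypothesis measurable_cell : forall a, measurable (cell idx a).

Definition quantized_close (k c : R) (mu nu : probability X R) :=
  [/\ (quantization_error dist idx p mu <= k%:E)%E,
      (quantization_error dist idx p nu <= k%:E)%E &
      forall a, `|fine (mu (cell idx a)) - fine (nu (cell idx a))| <= c].

Lemma quantized_closeC k c mu nu :
  quantized_close k c mu nu -> quantized_close k c nu mu.
Proof. by move=> [? ? H]; split => // a; rewrite distrC. Qed.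

(** Quantization errors and cell masses are linear in the measure, so convex combinations keep the
    same [k] and [c]. This makes the estimates uniform over the simplex. *)
Lemma quantized_close_mixture J (l : 'I_J -> R)
    (mus mus' : 'I_J -> probability X R) k c :
  @simplex R J l -> (forall j, quantized_close k c (mus j) (mus' j)) ->
  exists mu mu' : probability X R,
    [/\ mixture l (fun j => mus j : set X -> \bar R) = mu,
        mixture l (fun j => mus' j : set X -> \bar R) = mu' &
        quantized_close k c mu mu'].
Proof.
move=> [l0 l1] close.
have [q [qE qint]] := finite_mixture_exists mus l0 l1.
have [q' [q'E q'int]] := finite_mixture_exists mus' l0 l1.
have sumk (F : 'I_J -> \bar R) x : (forall j, F j <= x%:E)%E ->
    (\sum_(j < J) (l j)%:E * F j <= x%:E)%E.
  move=> Fx; rewrite -[x]mul1r -l1 mulr_suml -sumEFin; apply: lee_sum => j _.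
  by rewrite EFinM lee_wpmul2l// lee_fin.
have me : measurable_fun setT (fun x => (dist x (p (idx x)))%:E).
  exact: (measurable_quantization_error dist_metric dist_separable borel).
have e0 x : (0 <= (dist x (p (idx x)))%:E)%E by rewrite lee_fin metric_ge0.
have fineE (r : probability X R) (rs : 'I_J -> probability X R) a :
    (forall A, r A = \sum_(j < J) (l j)%:E * rs j A)%E ->
    fine (r (cell idx a)) = \sum_(j < J) l j * fine (rs j (cell idx a)).
  move=> rE; rewrite rE -sum_fine => [|j _]; last first.
    by rewrite fin_numM// fin_num_measure.
  by apply: eq_bigr => j _; rewrite fineM// fin_num_measure.
exists q, q'; split.
- by apply/funext => A; rewrite qE.
- by apply/funext => A; rewrite q'E.
split.
- by rewrite /quantization_error qint//; apply: sumk => j; case: (close j).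
- by rewrite /quantization_error q'int//; apply: sumk => j; case: (close j).
move=> a; rewrite (fineE _ _ _ qE) (fineE _ _ _ q'E) -sumrB.
apply: (le_trans (ler_norm_sum _ _ _)).
rewrite -[c]mul1r -l1 mulr_suml; apply: ler_sum => j _.
rewrite -mulrBr normrM ger0_norm// ler_wpM2l//.
by case: (close j).
Qed.

Lemma W1_mixture_perturbation J (l : 'I_J -> R)
    (mus mus' : 'I_J -> probability X R) (nu nu' : probability X R) k c Dm :
  @simplex R J l -> (forall j, quantized_close k c (mus j) (mus' j)) ->
  quantized_close k c nu nu' -> (forall a b, dist (p a) (p b) <= Dm) ->
  (W1 dist (mixture l (fun j => mus' j : set X -> \bar R)) nu' <=
   W1 dist (mixture l (fun j => mus j : set X -> \bar R)) nu +
   (4 * k + Dm * (2 * #|I|%:R * c))%:E)%E.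
Proof.
move=> sl close [enu enu' cnu] pDm.
have [mu [mu' [-> -> [emu emu' cmu]]]] := quantized_close_mixture sl close.
exact: (W1_quantized_stability dist_metric dist_separable borel measurable_cell
  emu enu emu' enu' pDm cmu cnu).
Qed.

(* Q is within err of Qhat on the simplex, hence the minimizer of Qhat
   minimizes Q up to 2 err. *)
Lemma argmin_perturbation J (mus mus' : 'I_J -> probability X R)
    (nu nu' : probability X R) (eta k c Dm : R) (y0 : X) (lstar lhat : 'I_J -> R) :
  0 < eta ->
  (\int[nu]_y (dist y y0)%:E < +oo)%E ->
  (forall j, \int[mus j]_y (dist y y0)%:E < +oo)%E ->
  (forall j, quantized_close k c (mus j) (mus' j)) ->
  quantized_close k c nu nu' -> (forall a b, dist (p a) (p b) <= Dm) ->
  is_argmin (objective dist eta (fun j => mus j : set X -> \bar R) nu) lstar ->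
  is_argmin (objective dist eta (fun j => mus' j : set X -> \bar R) nu') lhat ->
  eta * \sum_(i < J) (lhat i - lstar i) ^+ 2 <=
    16 * (4 * k + Dm * (2 * #|I|%:R * c)).
Proof.
move=> eta0 nuoo musoo close closenu pDm amin [shat ahat].
set err := 4 * k + _.
have sstar := proj1 amin.
rewrite (_ : 16 * err = 8 * (2 * err)); last by ring.
apply: (near_argmin_close dist_metric dist_separable borel eta0 nuoo musoo amin shat).
have W1le := W1_mixture_perturbation shat (fun j => quantized_closeC (close j))
  (quantized_closeC closenu) pDm.
have W2le := W1_mixture_perturbation sstar close closenu pDm.
have := ahat _ sstar; rewrite /objective => Qle.
move: W1le W2le Qle; rewrite -/err.
set w := W1 _ _ _; set w' := W1 _ _ _; set v := W1 _ _ _; set v' := W1 _ _ _.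
move=> W1le W2le Qle.
(* With [Qhat] the objective of [mus'] and [nu'], the chain is [Q lhat <= Qhat lhat + err <= Qhat
   lstar + err <= Q lstar + 2 * err]. *)
apply: (@le_trans _ _ (w' + err%:E + (eta * \sum_(i < J) xlogx (lhat i))%:E)%E).
  exact: leeD2r.
rewrite addeAC; apply: (@le_trans _ _ (v + (eta * \sum_(i < J) xlogx (lstar i))%:E + err%:E)%E).
  exact: leeD2r.
rewrite addeAC; apply: (@le_trans _ _
  (v' + err%:E + err%:E + (eta * \sum_(i < J) xlogx (lstar i))%:E)%E).
  by rewrite leeD2r// leeD2r.
rewrite -!addeA -!EFinD (_ : err + _ = eta * \sum_(i < J) xlogx (lstar i) + 2 * err)//.
by ring.
Qed.

Context {dO : measure_display} {Omega : measurableType dO}.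

(** Outside two kinds of events the sample is good: a sample mean of distances to centres above [k]
    (Markov, using the bound [k * kappa]), and a cell frequency off by more than [c] (Chebyshev).
    Each kind has probability at most [kappa]. *)
Lemma empirical_quantized_close (Pr : probability Omega R)
    (Z : nat -> Omega -> X) (P : probability X R) (k c kappa : R) :
  iid_with_law Pr Z P -> 0 < k -> 0 < c -> 0 < kappa <= 1 ->
  (quantization_error dist idx p P <= (k * kappa)%:E)%E ->
  eventually_small Pr (fun N => [set w | ~ exists2 q : probability X R,
      empirical N Z w = q & quantized_close k c P q]) (2 * kappa).
Proof.
move=> iid k0 c0 /andP[kappa0 kappa1] eP.
have [mZ lawZ indZ] := iid.
pose f x := dist x (p (idx x)).
have mf : measurable_fun setT f.
  by apply/measurable_EFinP; exact: (measurable_quantization_error dist_metric dist_separable borel).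
have f0 x : 0 <= f x by exact: metric_ge0.
(* The share of [kappa] given to each cell; the successor keeps the denominator positive. *)
pose kappa2 := kappa / #|I|.+1%:R.
have kappa20 : 0 < kappa2 by rewrite divr_gt0.
pose pr a := fine (P (cell idx a)).
pose freq a N w : R := \sum_(i < N) \1_(Z i @^-1` cell idx a) w.
have smallf a : eventually_small Pr
    (fun N => [set w | c < `|freq a N w / N%:R - pr a|]) kappa2.
  have PC : P (cell idx a) = (pr a)%:E by rewrite fineK// fin_num_measure.
  apply: (@frequency_concentration _ _ _ Pr (fun i => Z i @^-1` cell idx a)) => //.
  - by move=> i; rewrite -[X in measurable X]setTI; exact: mZ.
  - by move=> i; rewrite lawZ.
  - move=> i j ij.
    have := indZ [:: i; j] (fun=> cell idx a).
    rewrite /= inE ij => /(_ isT (fun=> measurable_cell a)).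
    rewrite !big_cons big_nil mule1 !lawZ// PC -EFinM => <-; congr (Pr _).
    apply/seteqP; split => [w [wi wj] x /=|w H].
      by rewrite !inE => /orP[]/eqP ->.
    by split; apply: H; rewrite /= !inE eqxx ?orbT.
have smalle := sample_mean_small iid mf f0 k0 eP.
apply: (eventually_small_sub _ _
  (eventually_smallU smalle (eventually_small_bigcup smallf))); last first.
  rewrite (mulr_natl kappa 2) mulr2n lerD2l /kappa2 mulrA ler_pdivrMr// mulrC.
  by rewrite ler_wpM2l ?ler_nat// ltW.
move=> N N0 w /= noq; apply: contrapT => /not_orP[ew cw]; apply: noq.
have [q [qE qint]] := empirical_probability (R := R) Z w N0.
exists q; first by apply/funext => A; rewrite qE.
split.
- by apply: (le_trans eP); rewrite lee_fin ler_piMr// ltW.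
- by rewrite /quantization_error qint// lee_fin leNgt; apply/negP.
move=> a; rewrite distrC leNgt; apply/negP => H; apply: cw; exists a => //=.
move: H; rewrite -qE /empirical.
rewrite (eq_bigr (fun i : 'I_N => (\1_(Z i @^-1` cell idx a) w)%:E)).
  by rewrite sumEFin -EFinM /= mulrC.
by move=> i _; rewrite diracE indicE; congr (_%:R%:E); apply/idP/idP; rewrite !inE.
Qed.

End Consistency.

(** By contraposition: otherwise every [|z i|] is at most [eps / J.+1], and the [J] terms sum to at
    most [eps]. The successor covers [J = 0]. *)
Lemma l1_gt_sum_sqr_gt {R : realType} (J : nat) (z : 'I_J -> R) (eps : R) :
  0 < eps -> eps < \sum_(i < J) `|z i| ->
  (eps / J.+1%:R) ^+ 2 < \sum_(i < J) z i ^+ 2.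
Proof.
move=> eps0; apply: contraTT; rewrite -!leNgt => zle.
have zi i : `|z i| <= eps / J.+1%:R.
  rewrite -(@ler_pXn2r _ 2)// ?nnegrE ?divr_ge0// ?(ltW eps0)//.
  apply: le_trans zle; rewrite real_normK ?num_real//.
  by rewrite (bigD1 i)//= lerDl sumr_ge0// => j _; rewrite sqr_ge0.
apply: (@le_trans _ _ (\sum_(i < J) eps / J.+1%:R)); first exact: ler_sum.
rewrite sumr_const card_ord -[leLHS]mulr_natr -mulrA ler_piMr ?(ltW eps0)//.
by rewrite mulrC ler_pdivrMr// mul1r ler_nat.
Qed.

Theorem theorem3 (R : realType)
  (dX : measure_display) (X : measurableType dX) (dist : X -> X -> R)
  (dO : measure_display) (Omega : measurableType dO) (Pr : probability Omega R)
  (J : nat) (P1 : probability X R) (P : 'I_J -> probability X R)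
  (eta : R)
  (Y1 : nat -> Omega -> X) (Y : 'I_J -> nat -> Omega -> X)
  (lamhat : nat -> Omega -> 'I_J -> R) (lamstar : 'I_J -> R) :
  is_metric dist -> metric_complete dist -> metric_separable dist ->
  @measurable _ X = <<s metric_open dist >> ->
  (exists y0 : X, (\int[P1]_y (dist y y0)%:E < +oo)%E /\
                  forall j, (\int[P j]_y (dist y y0)%:E < +oo)%E) ->
  (forall alpha : 'I_J -> R, \sum_(j < J) alpha j = 0 ->
     (forall A : set X, measurable A -> (\sum_(j < J) (alpha j)%:E * P j A)%E = 0%E) ->
     forall j, alpha j = 0) ->
  0 < eta ->
  iid_with_law Pr Y1 P1 -> (forall j, iid_with_law Pr (Y j) (P j)) ->
  (forall N w, (0 < N)%N ->
     is_argmin (objective dist eta (fun j => empirical N (Y j) w) (empirical N Y1 w))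
               (lamhat N w)) ->
  is_argmin (objective dist eta (fun j => (P j : set X -> \bar R)) (P1 : set X -> \bar R))
            lamstar ->
  cvg_in_outer_prob Pr lamhat lamstar.
Proof.
move=> metric _ separable borel [y0 [P1oo Poo]] _ eta0 iid1 iid ahat astar.
move=> eps delta eps0 delta0.
(* The target law is joined to the others as index [None], so that one quantizer and one union bound
   serve all [J.+1] laws. *)
pose Pf (o : option 'I_J) := if o is Some j then P j else P1.
pose Zf (o : option 'I_J) := if o is Some j then Y j else Y1.
have iidf o : iid_with_law Pr (Zf o) (Pf o) by case: o.
(* Chosen so that [16 * err], the bound of [argmin_perturbation], is [eta] times the threshold of
   [l1_gt_sum_sqr_gt]. Half of [err] goes to [4 * k], the other half to the cell frequencies through
   [c]. *)
pose err := eta * (eps / J.+1%:R) ^+ 2 / 16.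
have err0 : 0 < err by rewrite !divr_gt0// mulr_gt0// exprn_gt0// divr_gt0.
pose k := err / 8; have k0 : 0 < k by rewrite divr_gt0.
(* Each of the [J.+1] laws fails with probability at most [2 * kappa], for a total of at most
   [delta / 2]. *)
pose kappa := Num.min 1 (delta / (4 * J.+1%:R)).
have kappa01 : 0 < kappa <= 1.
  by rewrite lt_min ltr01 divr_gt0//= ge_min lexx.
have kappa0 : 0 < kappa by case/andP: kappa01.
have kd : J.+1%:R * (2 * kappa) < delta.
  apply: (@le_lt_trans _ _ (J.+1%:R * (2 * (delta / (4 * J.+1%:R))))).
    by rewrite !ler_wpM2l// ge_min lexx orbT.
  have fieldE (M : R) : M != 0 -> M * (2 * (delta / (4 * M))) = delta / 2.
    by move=> M0; field.
  rewrite fieldE ?pnatr_eq0//.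
  by rewrite ltr_pdivrMr// ltr_pMr// ltr1n.
have Pfoo o : (\int[Pf o]_y (dist y y0)%:E < +oo)%E by case: o.
have [m [idx [p [mcell eP]]]] :=
  quantizer_exists metric separable borel Pfoo (mulr_gt0 k0 kappa0).
(* The sum of all distances between centres is a crude bound for their maximum. *)
pose Dm := \sum_(ab : 'I_m.+1 * 'I_m.+1) dist (p ab.1) (p ab.2).
have pDm a b : dist (p a) (p b) <= Dm.
  rewrite /Dm (bigD1 (a, b))//= lerDl sumr_ge0// => ab _.
  exact: metric_ge0.
have Dm0 : 0 <= Dm by apply: sumr_ge0 => ab _; exact: metric_ge0.
(* The added 1 keeps the denominator positive when all centres coincide. The quantizer, hence [Dm],
   is fixed before [c] and [N]. *)
pose c := err / 2 / (Dm * (2 * m.+1%:R) + 1).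
have den0 : 0 < Dm * (2 * m.+1%:R) + 1.
  by rewrite ltr_wpDl// mulr_ge0// mulr_ge0.
have c0 : 0 < c by rewrite divr_gt0// divr_gt0.
have errle : 4 * k + Dm * (2 * #|'I_m.+1|%:R * c) <= err.
  rewrite card_ord (_ : 4 * k = err / 2); last by rewrite /k; field.
  rewrite [leRHS]splitr lerD2l.
  rewrite (_ : Dm * _ = err / 2 * (Dm * (2 * m.+1%:R) /
    (Dm * (2 * m.+1%:R) + 1))); last by rewrite /c; ring.
  apply: ler_piMr; first by rewrite divr_ge0// ltW.
  by rewrite ler_pdivrMr// mul1r lerDl.
have := eventually_small_bigcup (fun o => empirical_quantized_close metric
  separable borel mcell (iidf o) k0 c0 kappa01 (eP o)).
rewrite card_option card_ord => -[N0 H]; exists N0.+1 => N NN.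
have [B [mB sB] PB] := H _ (ltnW NN).
exists B; last by apply: (le_lt_trans PB); rewrite lte_fin.
split=> //; apply: subset_trans sB => w /= epsw.
apply: contrapT => good.
have {}good o : exists q : probability X R, empirical N (Zf o) w = q /\
    quantized_close dist idx p k c (Pf o) q.
  apply: contrapT => bad; apply: good; exists o => // -[q qE qc].
  by apply: bad; exists q.
have [q1 [q1E close1]] := good None.
have /choice[q qP] := fun j => good (Some j).
have Npos : (0 < N)%N by exact: leq_ltn_trans NN.
have := ahat N w Npos; rewrite [empirical N Y1 w]q1E.
rewrite (_ : (fun j => empirical N (Y j) w) = (fun j => q j : set X -> \bar R));
  last by apply/funext => j; case: (qP j).
move=> ahatq.
(* On the good event the minimizers are too close for the l1 distance to exceed [eps], a
   contradiction. *)
have := argmin_perturbation metric separable borel mcell eta0 P1oo Poo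
  (fun j => proj2 (qP j)) close1 pDm astar ahatq.
apply/negP; rewrite -ltNge.
apply: (@le_lt_trans _ _ (16 * err)); first by rewrite ler_wpM2l.
rewrite /err [16 * _]mulrC divfK ?pnatr_eq0// ltr_pM2l//.
exact: l1_gt_sum_sqr_gt.
Qed.
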